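(* For every integer $n\ge 2$ there exists a measurable, piecewise monotone $n$-de Bruijn-Erdős-set $A\subset[0,1]^n$ such that \[\mathcal{H}^1(A)=n-1.\]
   Context: For a positive integer $n\ge 2$, an $n$-de Bruijn-Erdős-set ($n$-dBE-set) is a measurable set $A\subset [0,1]^n$ such that for any two distinct points $\mathbf{x}=(x_1,\ldots, x_n)$ and $\mathbf{y} = (y_1,\ldots,y_n)$ in $A$ there exists a unique $i\in \{1,\ldots,n\}$ with $x_i=y_i$. A monotone function means a function that is either strictly increasing or strictly decreasing. An injective, measurable function $f:[0,1]\to[0,1]$ is called piecewise monotone if there exists a countable partition of $[0,1]$ into disjoint measurable sets $\{S_j\}_{j\ge 1}$ such that for every $j$ the restriction of $f$ to $S_j$ is a monotone function. An $n$-dBE-set $A$ is called piecewise monotone if it is of the form \[A=\{(x,f_1(x),\ldots,f_{n-2}(x),\alpha): x\in [0,1]\},\] where $\alpha\in [0,1]$ is fixed and each function $f_i:[0,1]\to[0,1]$, $i\in\{1,\ldots,n-2\}$, is (injective, measurable and) piecewise monotone. For $A\subset\mathbb{R}^n$ and $\delta>0$, let $\mathcal{H}_{\delta}^{1}(A) = \inf \{ \sum_{i}\operatorname{diam}(U_i): A \subset \bigcup_i U_i,\ \operatorname{diam}(U_i)\le \delta \}$, the infimum being over at most countable covers of $A$ (diameter with respect to the Euclidean distance). The $1$-dimensional Hausdorff measure is $\mathcal{H}^1(A)=\lim_{\delta\to 0_+}\mathcal{H}^1_\delta(A)$. *)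

(* Defs.v *)
From HB Require Import structures.
From mathcomp Require Import all_boot all_order all_algebra.
From mathcomp Require Import all_classical all_reals all_analysis.

Set Implicit Arguments.
Unset Strict Implicit.
Unset Printing Implicit Defensive.

Import Order.TTheory GRing.Theory Num.Theory.
Import numFieldNormedType.Exports.

Local Open Scope classical_set_scope.
Local Open Scope ring_scope.

(* Points of R^n are n-tuples. [measurable] on [n.-tuple R] is the product of
   the Borel sigma-algebras of the coordinates, i.e. the Borel sets of R^n. *)

Definition eucl_dist (R : realType) (n : nat) (x y : n.-tuple R) : R :=
  Num.sqrt (\sum_(i < n) (tnth x i - tnth y i) ^+ 2).

(* The extra element 0 only matters for the empty set, whose diameter is 0
   (the supremum of the empty set in \bar R being -oo). *)
Definition diam (R : realType) (n : nat) (U : set (n.-tuple R)) : \bar R :=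
  ereal_sup (0%E |` [set d | exists x y, [/\ U x, U y & d = (eucl_dist x y)%:E]]).

(* Finite covers are included: pad them with empty sets. *)
Definition hausdorff1_delta (R : realType) (n : nat) (A : set (n.-tuple R))
    (delta : R) : \bar R :=
  ereal_inf [set s | exists U : nat -> set (n.-tuple R),
    [/\ A `<=` \bigcup_i U i,
        (forall i, (diam (U i) <= delta%:E)%E)
      & s = (\sum_(0 <= i <oo) diam (U i))%E]].

Definition hausdorff1 (R : realType) (n : nat) (A : set (n.-tuple R)) : \bar R :=
  lim (hausdorff1_delta A delta @[delta --> 0^'+]).

Definition dBE_set (R : realType) (n : nat) (A : set (n.-tuple R)) : Prop :=
  [/\ measurable A,
      (forall x, A x -> forall i, 0 <= tnth x i <= 1)
    & (forall x y, A x -> A y -> x <> y ->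
         exists! i : 'I_n, tnth x i = tnth y i)].

Definition monotone_on (R : realType) (S : set R) (f : R -> R) : Prop :=
  (forall x y, S x -> S y -> x < y -> f x < f y) \/
  (forall x y, S x -> S y -> x < y -> f y < f x).

(* Functions [0,1] -> [0,1] are represented by functions R -> R, of which only
   the values on [0,1] matter. Some of the pieces S j may be empty. *)
Definition piecewise_monotone (R : realType) (f : R -> R) : Prop :=
  [/\ (forall x : R, 0 <= x <= 1 -> 0 <= f x <= 1),
      (forall x y : R, 0 <= x <= 1 -> 0 <= y <= 1 -> f x = f y -> x = y),
      measurable_fun (`[0, 1]%classic : set R) f
    & exists S : nat -> set R,
        [/\ (forall j, measurable (S j)), trivIset setT S,
            \bigcup_j S j = `[0, 1]%classic
          & forall j, monotone_on (S j) f]].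

(* The point (x, f_1(x), ..., f_{n-2}(x), alpha), for n >= 2; of the family f
   only f 1, ..., f (n - 2) are used. *)
Definition graph_point (R : realType) (n : nat) (f : nat -> R -> R) (alpha : R)
    (x : R) : n.-tuple R :=
  [tuple if i == 0%N :> nat then x
         else if (i <= n - 2)%N then f i x else alpha | i < n].

Definition piecewise_monotone_dBE_set (R : realType) (n : nat)
    (A : set (n.-tuple R)) : Prop :=
  dBE_set A /\
  exists (f : nat -> R -> R) (alpha : R),
    [/\ 0 <= alpha <= 1,
        (forall i, (1 <= i <= n - 2)%N -> piecewise_monotone (f i))
      & A = [set graph_point n f alpha x | x in `[0, 1]%classic]].

(* Main.v *)
Require Import Defs.
From mathcomp Require Import all_boot all_order all_algebra.
From mathcomp Require Import all_classical all_reals all_analysis.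
From mathcomp Require Import measurable_realfun.
From mathcomp Require Import ring lra zify.

(** A curve that increases strictly in each of its n - 1 moving coordinates has
length at most n - 1, the sum of its total variations, and the bound is
attained when at almost every point only one coordinate is really moving. The
set A is such a curve, with last coordinate constantly 0. Distinct points of A
then share the last coordinate and no other one, so A is a de Bruijn-Erdos set
for a trivial reason, and each f_i is monotone on the whole of [0,1]. Only the
value of H^1 needs work.

The curve is the limit of nested chains of boxes. The chain of level k consists
of n ^ k boxes, each running from the top corner of the previous one. A box is
replaced by n boxes chained along its diagonal: the s-th child receives the
proportion (k+1)/(k+2) of side s and the remaining 1/(k+2) of side s is divided
equally between the other children ([weight]). These proportions have two
opposite virtues. The product of the (k+1)/(k+2) telescopes to 1/(k+1), so the
boxes shrink to points and the chain defines a continuous curve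
([cell_len_le]). On the other hand (k+1)/(k+2) tends to 1, so at a late level
the boxes that are s-th children carry almost the whole variation of coordinate
s: these families of boxes are disjoint for distinct s, which says that the
coordinates are mutually singular ([sum_core_len]). Thus singularity is visible
at a single level, with no law of large numbers.

The corners of the boxes are kept one coordinate at a time: [node k j i] is
the i-th coordinate of the j-th corner of level k. As corners are ordered in
the same way by all coordinates ([node_order]), there is an increasing map
[transfer i i'] sending i-th to i'-th coordinates of corners, and
f_i = [transfer 0 i].

Upper bound ([hausdorff1_delta_le]): the boxes of level k cover A, and their
diameters are at most the sums of their n - 1 sides, which add up to n - 1.
Lower bound ([hausdorff1_delta_ge]): in each box of level k + 1 that is an
s-th child with s < n - 1, cut off the ends of the arc by a small amount in
coordinate s. The resulting arcs are at positive distance from each other, so a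
set of small diameter meets at most one of them; and the sets meeting one arc
have total diameter at least the length of its projection to coordinate s. The
sum of these lengths tends to n - 1. *)

Set Implicit Arguments.
Unset Strict Implicit.
Unset Printing Implicit Defensive.

Import Order.TTheory GRing.Theory Num.Theory.
Import numFieldNormedType.Exports.

Local Open Scope classical_set_scope.
Local Open Scope ring_scope.

(** * Corners of the nested boxes *)

Section Nodes.
Variables (R : realType) (D : nat).
Hypothesis D_gt1 : (1 < D)%N.

Definition weight (k s i : nat) : R :=
  if s == i then k.+1%:R / k.+2%:R else (D.-1%:R * k.+2%:R)^-1.

(** The digits of [l] in base [D], the last one being [l %% D], are the successive
child numbers leading to box [l] of level [k]. Side [i] is meant for [i < D]; a
level has infinitely many boxes, of which the first [D ^ k] subdivide the unit
box. *)
Fixpoint cell_len (k l i : nat) : R :=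
  if k is k'.+1 then cell_len k' (l %/ D) i * weight k' (l %% D) i else 1.

Definition node (k j i : nat) : R := \sum_(0 <= l < j) cell_len k l i.

Definition in_cell (k j i : nat) (x : R) := node k j i <= x <= node k j.+1 i.

Let D_gt0 : (0 < D)%N. Proof. exact: ltnW. Qed.

Let D1_gt0 : 0 < D.-1%:R :> R.
Proof. by rewrite ltr0n -subn1 subn_gt0. Qed.

Lemma weight_gt0 k s i : 0 < weight k s i.
Proof.
rewrite /weight; case: ifP => _; first by rewrite divr_gt0 ?ltr0n.
by rewrite invr_gt0 mulr_gt0// ltr0n.
Qed.

Lemma weight_le k s i : weight k s i <= k.+1%:R / k.+2%:R.
Proof.
rewrite /weight; case: ifP => // _.
have k2 : 0 < k.+2%:R :> R by rewrite ltr0n.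
rewrite invfM ler_pM2r ?invr_gt0//.
rewrite (@le_trans _ _ 1)// ?ler1n// invf_le1// ler1n.
by rewrite -subn1 subn_gt0.
Qed.

Lemma sum_weight k i : (i < D)%N -> \sum_(0 <= s < D) weight k s i = 1.
Proof.
move=> iD; rewrite big_mkord (bigD1 (Ordinal iD))//= {1}/weight eqxx.
rewrite (eq_bigr (fun=> (D.-1%:R * k.+2%:R)^-1)); last first.
  by move=> s; rewrite /weight -val_eqE/= => /negbTE ->.
rewrite sumr_const.
have -> : #|[pred s : 'I_D | s != Ordinal iD]| = D.-1.
  by rewrite -[in RHS](card_ord D) -(cardC1 (Ordinal iD)).
rewrite -mulr_natr -[k.+2]addn1 natrD.
have ? : 0 <= k%:R :> R by rewrite ler0n.
have ? := D1_gt0; rewrite -addn1 natrD; field.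
by apply/andP; split; rewrite gt_eqF//; lra.
Qed.

Lemma cell_len_gt0 k l i : 0 < cell_len k l i.
Proof.
by elim: k l => [|k IH] l//=; rewrite mulr_gt0 ?weight_gt0.
Qed.

Lemma cell_len_le k l i : cell_len k l i <= k.+1%:R^-1.
Proof.
elim: k l => [|k IH] l/=; first by rewrite invr1.
rewrite (@le_trans _ _ (k.+1%:R^-1 * (k.+1%:R / k.+2%:R)))//.
  by rewrite ler_pM ?weight_le// ltW ?cell_len_gt0 ?weight_gt0.
by rewrite mulKf// pnatr_eq0.
Qed.

Lemma node0 k i : node k 0 i = 0.
Proof. by rewrite /node big_nil. Qed.

Lemma nodeS k j i : node k j.+1 i = node k j i + cell_len k j i.
Proof. by rewrite /node big_nat_recr. Qed.

Lemma node_root j i : node 0 j i = j%:R.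
Proof. by rewrite /node sumr_const_nat subn0. Qed.

Lemma node_mono k i : {mono node k ^~ i : j j' / (j <= j')%N >-> j <= j'}.
Proof.
apply: (@le_mono _ _ nat) => j j'; rewrite ltEnat/=; elim: j' => // j' IH.
rewrite ltnS leq_eqVlt => /orP[/eqP ->|/IH jj'].
  by rewrite nodeS ltrDl cell_len_gt0.
by rewrite (lt_trans jj')// nodeS ltrDl cell_len_gt0.
Qed.

Lemma node_ge0 k j i : 0 <= node k j i.
Proof. by rewrite -(node0 k i) node_mono. Qed.

(** Sums over the boxes of level [k.+1] whose last digit is restricted: with no
restriction it gives the refinement of corners, with a single digit the part
of the variation carried by one family of children. *)
Lemma node_children k j i (P : pred nat) :
  \sum_(0 <= l < D * j | P (l %% D)%N) cell_len k.+1 l i =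
  \sum_(0 <= l < j) cell_len k l i * \sum_(0 <= s < D | P s) weight k s i.
Proof.
elim: j => [|j IH]; first by rewrite muln0 !big_nil.
rewrite big_nat_recr//= -IH mulnS addnC.
rewrite (@big_cat_nat _ _ _ (D * j)%N)//= ?leq_addr//; congr (_ + _).
rewrite -{1}[(D * j)%N]add0n big_addn addKn mulr_sumr.
apply: congr_big_nat => // [s|s] /andP[_]; rewrite ?andbT => sD.
  by rewrite addnC mulnC modnMDl modn_small.
case/andP: sD => _ sD.
by rewrite addnC mulnC modnMDl divnMDl// divn_small// addn0 modn_small.
Qed.

Lemma node_refine k j i : (i < D)%N -> node k.+1 (D * j) i = node k j i.
Proof.
move=> iD; rewrite /node (node_children k j i xpredT).
by apply: eq_bigr => l _; rewrite sum_weight// mulr1.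
Qed.

Lemma node_refineX m k j i : (i < D)%N -> node (m + k) (D ^ m * j) i = node k j i.
Proof.
move=> iD; elim: m => [|m IH]; first by rewrite expn0 mul1n.
by rewrite addSn expnS -mulnA node_refine.
Qed.

Lemma node_end k i : (i < D)%N -> node k (D ^ k) i = 1.
Proof.
by move=> iD; rewrite -[k in node k]addn0 -[(D ^ k)%N]muln1 node_refineX// node_root.
Qed.

(** Two corners, possibly of different levels, are corners of a common finer
level, where their order is that of their indices in every coordinate. *)
Lemma node_order k k' j j' i i' : (i < D)%N -> (i' < D)%N ->
  node k j i <= node k' j' i -> node k j i' <= node k' j' i'.
Proof.
move=> iD iD'.
rewrite -(node_refineX k' k j iD) -(node_refineX k k' j' iD).
rewrite -(node_refineX k' k j iD') -(node_refineX k k' j' iD').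
by rewrite [(k' + k)%N]addnC !node_mono.
Qed.

Lemma in_cell_exists k i x : (i < D)%N -> 0 <= x <= 1 ->
  exists2 j, (j < D ^ k)%N & in_cell k j i x.
Proof.
move=> iD /andP[x0 x1].
have P : exists j, x <= node k j.+1 i.
  by exists (D ^ k).-1; rewrite prednK ?expn_gt0 ?D_gt0// node_end.
exists (ex_minn P); case: ex_minnP => j xj jmin.
  have := jmin (D ^ k).-1; rewrite prednK ?expn_gt0 ?D_gt0// node_end// => /(_ x1).
  by move/leq_ltn_trans; apply; rewrite prednK// expn_gt0 D_gt0.
rewrite /in_cell xj andbT.
case: j xj jmin => [|j] xj jmin; first by rewrite node0.
by rewrite leNgt; apply/negP => /ltW /jmin; rewrite ltnn.
Qed.

Lemma in_cell_dist k j i x y : in_cell k j i x -> in_cell k j i y ->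
  `|x - y| <= cell_len k j i.
Proof.
rewrite /in_cell nodeS => /andP[? ?] /andP[? ?]; rewrite ler_norml; lra.
Qed.

(** Boxes shrink to points: this is how all identities between values of the
limit curve are obtained. *)
Lemma in_cell_eq i x y :
  (forall k, exists2 j, in_cell k j i x & in_cell k j i y) -> x = y.
Proof.
move=> h; apply/eqP; rewrite -subr_eq0 -normr_le0 leNgt; apply/negP => e0.
have [k ke] := ltr_add_invr e0.
have [j cx cy] := h k.
have := le_trans (in_cell_dist cx cy) (cell_len_le k j i).
by rewrite add0r in ke; rewrite leNgt ke.
Qed.

(** * Coordinate changes along the limit curve *)

Definition nodes_below (i i' : nat) (x : R) : set R :=
  [set y | exists k j, node k j i <= x /\ y = node k j i'].

Definition transfer (i i' : nat) (x : R) : R := sup (nodes_below i i' x).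

Lemma nodes_below_ubound k j i i' x : (i < D)%N -> (i' < D)%N ->
  x <= node k j i -> ubound (nodes_below i i' x) (node k j i').
Proof.
move=> iD iD' xj _ [k' [j' [h ->]]].
by apply: node_order iD iD' _; exact: le_trans xj.
Qed.

Lemma has_sup_nodes_below i i' x : (i < D)%N -> (i' < D)%N -> 0 <= x ->
  has_sup (nodes_below i i' x).
Proof.
move=> iD iD' x0; split; first by exists 0; exists 0%N, 0%N; rewrite !node0.
exists (node 0 (Num.bound x) i'); apply: nodes_below_ubound => //.
by rewrite node_root ltW// archi_boundP.
Qed.

Lemma transfer_cell k j i i' x : (i < D)%N -> (i' < D)%N ->
  in_cell k j i x -> in_cell k j i' (transfer i i' x).
Proof.
move=> iD iD' /andP[jx xj].
have ub := nodes_below_ubound iD iD' xj.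
have mem : nodes_below i i' x (node k j i') by exists k, j.
apply/andP; split; first by apply: ub_le_sup => //; exists (node k j.+1 i').
by apply: ge_sup => //; exists (node k j i').
Qed.

Lemma transfer_itv i i' x : (i < D)%N -> (i' < D)%N -> 0 <= x <= 1 ->
  0 <= transfer i i' x <= 1.
Proof.
move=> iD iD' x01.
have : in_cell 0 0 i x by rewrite /in_cell !node_root.
by move/(transfer_cell iD iD'); rewrite /in_cell !node_root.
Qed.

(** Staying in the boxes of all levels characterizes a point, and both maps
preserve them; this gives injectivity and surjectivity at once. *)
Lemma transferK i i' x : (i < D)%N -> (i' < D)%N -> 0 <= x <= 1 ->
  transfer i' i (transfer i i' x) = x.
Proof.
move=> iD iD' x01; apply: (@in_cell_eq i) => k.
have [j _ cj] := in_cell_exists k iD x01.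
by exists j => //; do 2 apply: transfer_cell => //.
Qed.

Lemma transfer_id i x : (i < D)%N -> 0 <= x <= 1 -> transfer i i x = x.
Proof.
move=> iD x01; apply: (@in_cell_eq i) => k.
have [j _ cj] := in_cell_exists k iD x01.
by exists j => //; apply: transfer_cell.
Qed.

(** Monotonicity holds on the whole line, hence measurability needs no
restriction: for negative arguments the set of corners is empty and its
supremum is 0 by convention, which exceeds no other value. *)
Lemma transfer_nondecreasing i i' : (i < D)%N -> (i' < D)%N ->
  {homo transfer i i' : x y / x <= y}.
Proof.
move=> iD iD' x y xy.
have sub : nodes_below i i' x `<=` nodes_below i i' y.
  by move=> _ [k [j [jx ->]]]; exists k, j; split => //; exact: le_trans xy.
have [y0|y0] := ltP y 0.
  have neg z : z < 0 -> nodes_below i i' z = set0.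
    move=> z0; apply/seteqP; split => // y' [k [j [jz y'E]]].
    by have := le_lt_trans (le_trans (node_ge0 k j i) jz) z0; rewrite ltxx.
  by rewrite /transfer !neg// (le_lt_trans xy).
have [e|/set0P ne] := eqVneq (nodes_below i i' x) set0; last first.
  apply: sup_le => //; last exact: has_sup_nodes_below.
  by move=> z /sub hz; exists z.
have [_ ub] := has_sup_nodes_below iD iD' y0.
by rewrite /transfer e sup0; apply: ub_le_sup => //; exists 0%N, 0%N; rewrite !node0.
Qed.

Lemma transfer_increasing i i' x y : (i < D)%N -> (i' < D)%N ->
  0 <= x <= 1 -> 0 <= y <= 1 -> x < y -> transfer i i' x < transfer i i' y.
Proof.
move=> iD iD' x01 y01 xy; rewrite lt_neqAle transfer_nondecreasing ?ltW// andbT.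
apply/eqP => e; move: xy.
by rewrite -(transferK iD iD' x01) e transferK// ltxx.
Qed.

End Nodes.

(** * Euclidean diameters *)

Section Diameter.
Variables (R : realType) (n : nat).
Implicit Types (x y : n.-tuple R) (U : set (n.-tuple R)).

Lemma coord_le_eucl_dist x y i : `|tnth x i - tnth y i| <= eucl_dist x y.
Proof.
rewrite -sqrtr_sqr ler_wsqrtr// (bigD1 i)//= lerDl.
by apply: sumr_ge0 => j _; exact: sqr_ge0.
Qed.

Lemma eucl_dist_le_sum x y : eucl_dist x y <= \sum_(i < n) `|tnth x i - tnth y i|.
Proof.
have s0 : 0 <= \sum_(i < n) `|tnth x i - tnth y i| by apply: sumr_ge0.
rewrite -[leRHS](ger0_norm s0) -sqrtr_sqr ler_wsqrtr//.
suff [] : \sum_(i < n) (tnth x i - tnth y i) ^+ 2 <=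
    (\sum_(i < n) `|tnth x i - tnth y i|) ^+ 2 /\
    0 <= \sum_(i < n) `|tnth x i - tnth y i| by [].
(* The nonnegativity of the sum is needed to discard the cross terms. *)
apply: (big_ind2 (fun a b : R => a <= b ^+ 2 /\ 0 <= b)).
- by rewrite expr0n lexx.
- move=> a b a' b' [ab b0] [ab' b0']; split; last exact: addr_ge0.
  by rewrite sqrrD addrAC ler_wpDr ?lerD// mulrn_wge0// mulr_ge0.
- by move=> i _; rewrite real_normK ?num_real.
Qed.

Lemma eucl_dist_le_diam U x y : U x -> U y -> ((eucl_dist x y)%:E <= diam U)%E.
Proof. by move=> Ux Uy; apply: ereal_sup_ubound; right; exists x, y. Qed.

Lemma diam_ge0 U : (0 <= diam U)%E.
Proof. by apply: ereal_sup_ubound; left. Qed.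

Lemma diam_le U (d : R) : 0 <= d ->
  (forall x y, U x -> U y -> eucl_dist x y <= d) -> (diam U <= d%:E)%E.
Proof.
move=> d0 h; apply: ge_ereal_sup => _ [->|[x [y [Ux Uy ->]]]].
  by rewrite lee_fin.
by rewrite lee_fin h.
Qed.

End Diameter.

(** * Covers of an interval by sets of small diameter *)

Section IntervalCover.
Variable R : realType.

Lemma measurable_hull (V : set R) (w : \bar R) : (0 <= w)%E ->
  (forall s t, V s -> V t -> (`|s - t|%:E <= w)%E) ->
  exists W : set R, [/\ measurable W, V `<=` W & (lebesgue_measure W <= w)%E].
Proof.
case: w => [r| |] // r0 h; last by exists setT; split=> //; rewrite leey.
have [->|/set0P V0] := eqVneq V set0.
  by exists set0; split=> //; rewrite measure0.
have r0' : 0 <= r by rewrite -lee_fin.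
have d s t : V s -> V t -> s - r <= t <= s + r.
  by move=> Vs Vt; have := h _ _ Vs Vt; rewrite lee_fin ler_norml; lra.
exists `[inf V, inf V + r]%classic; split; first exact: measurable_itv.
  move=> t Vt /=; rewrite in_itv/=; apply/andP; split.
    apply: ge_inf => //; exists (t - r) => s Vs.
    by have /andP[] := d _ _ Vt Vs.
  rewrite -lerBlDr; apply: lb_le_inf => // s Vs.
  by have /andP[] := d _ _ Vt Vs.
rewrite lebesgue_measure_itv/=; case: ifPn => // _.
by rewrite -EFinB lee_fin addrC addKr.
Qed.

(** The covering sets are arbitrary, hence the passage to measurable hulls before
sigma-subadditivity of the Lebesgue measure. *)
Lemma itv_cover_le (a b : R) (V : nat -> set R) (w : nat -> \bar R) :
  (forall m, (0 <= w m)%E) ->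
  (forall m s t, V m s -> V m t -> (`|s - t|%:E <= w m)%E) ->
  `[a, b] `<=` \bigcup_m V m ->
  ((b - a)%:E <= \sum_(0 <= m <oo) w m)%E.
Proof.
move=> w0 hV cov.
have [W hW] := choice (fun m => measurable_hull (w0 m) (@hV m)).
have [ab|ba] := ltP a b; last first.
  rewrite (@le_trans _ _ 0%E)// ?nneseries_ge0// lee_fin; lra.
have -> : (b - a)%:E = lebesgue_measure `[a, b]%classic :> \bar R.
  by rewrite lebesgue_measure_itv/= lte_fin ab EFinB.
apply: (@le_trans _ _ (\sum_(0 <= m <oo) lebesgue_measure (W m))%E).
  apply: measure_sigma_subadditive.
  - by move=> m; have [] := hW m.
  - exact: measurable_itv.
  - apply: subset_trans cov _ => x [m _ Vx]; exists m => //.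
    by have [_ + _] := hW m; apply.
by apply: lee_nneseries => // m _; have [] := hW m.
Qed.

End IntervalCover.

(** * The curve is a piecewise monotone de Bruijn-Erdos set *)

Lemma measurable_graph (R : realType) (n : nat) (g : 'I_n -> R -> R) (i0 : 'I_n) :
  (forall i, measurable_fun setT (g i)) ->
  measurable [set t : n.-tuple R | 0 <= tnth t i0 <= 1 /\
    forall i, tnth t i = g i (tnth t i0)].
Proof.
move=> mg.
have -> : [set t : n.-tuple R | 0 <= tnth t i0 <= 1 /\
    forall i, tnth t i = g i (tnth t i0)] =
  (fun t : n.-tuple R => tnth t i0) @^-1` `[0, 1]%classic `&`
  \bigcap_(i in [set: 'I_n])
    (fun t : n.-tuple R => tnth t i - g i (tnth t i0)) @^-1` [set 0].
  apply/seteqP; split => t /=; rewrite ?in_itv/=.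
    by move=> [t0 h]; split => // i _ /=; rewrite [in LHS]h subrr.
  move=> [t0 h]; split => // i; apply/eqP; rewrite -subr_eq0; apply/eqP.
  exact: h.
apply: measurableI.
  by rewrite -[X in measurable X]setTI; apply: measurable_tnth.
apply: fin_bigcap_measurable => // i _.
rewrite -[X in measurable X]setTI.
apply: measurable_funB => //; first exact: measurable_tnth.
by apply: measurableT_comp => //; exact: measurable_tnth.
Qed.

Section Curve.
Variables (R : realType) (n : nat).
Hypothesis n_gt1 : (1 < n)%N.

Local Notation f := (@transfer R n 0).
Local Notation curve := (graph_point n f (0 : R)).
Local Notation A := [set curve x | x in `[0, 1]%classic].

Let n_gt0 : (0 < n)%N. Proof. exact: ltnW. Qed.

Let n1_lt i : (i < n.-1)%N -> (i < n)%N.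
Proof. by move=> h; apply: leq_trans h (leq_pred n). Qed.

Lemma tnth_curve x (i : 'I_n) : 0 <= x <= 1 -> (i < n.-1)%N ->
  tnth (curve x) i = f i x.
Proof.
move=> x01 i1; rewrite tnth_mktuple; case: eqP => [->|/eqP i0].
  by rewrite transfer_id.
by have -> : (i <= n - 2)%N by lia.
Qed.

Lemma tnth_curve_last x (i : 'I_n) : (n.-1 <= i)%N -> tnth (curve x) i = 0.
Proof.
move=> i1; rewrite tnth_mktuple; case: eqP => [|_]; first lia.
by have -> : (i <= n - 2)%N = false by have := ltn_ord i; lia.
Qed.

Lemma curve_itv x (i : 'I_n) : 0 <= x <= 1 -> 0 <= tnth (curve x) i <= 1.
Proof.
move=> x01; case: (ltnP i n.-1) => i1; last by rewrite tnth_curve_last ?lexx ?ler01.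
rewrite tnth_curve//; exact: transfer_itv.
Qed.

Lemma curve_inj x y (i : 'I_n) : 0 <= x <= 1 -> 0 <= y <= 1 -> (i < n.-1)%N ->
  tnth (curve x) i = tnth (curve y) i -> x = y.
Proof.
move=> x01 y01 i1; rewrite !tnth_curve// => /(congr1 (transfer n i 0)).
by rewrite !transferK.
Qed.

Lemma piecewise_monotone_transfer i : (i < n)%N -> piecewise_monotone (f i : R -> R).
Proof.
move=> iD; split.
- by move=> x; exact: transfer_itv.
- move=> x y x01 y01 /(congr1 (transfer n i 0)).
  by rewrite !transferK.
- by apply: nondecreasing_measurable; [exact: measurable_itv | exact: transfer_nondecreasing].
- exists (fun j => if j == 0%N then `[0, 1]%classic else set0); split.
  + by move=> j; case: ifP => _; [exact: measurable_itv | exact: measurable0].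
  + by move=> j j' _ _; do 2 case: eqP => [->|_] //; rewrite ?set0I ?setI0; case.
  + apply/seteqP; split => x; last by exists 0%N.
    by case=> j _; case: ifP.
  + move=> j; left; case: ifP => // _ x y /=.
    by rewrite !in_itv/=; exact: transfer_increasing.
Qed.

Lemma measurable_curve : measurable A.
Proof.
pose g (i : 'I_n) (x : R) : R := if i == 0%N :> nat then x
  else if (i <= n - 2)%N then f i x else 0.
pose i0 : 'I_n := Ordinal n_gt0.
have -> : A = [set t : n.-tuple R | 0 <= tnth t i0 <= 1 /\
    forall i, tnth t i = g i (tnth t i0)].
  apply/seteqP; split => [_ [x /=+ <-]|t /= [t0 h]]; rewrite ?in_itv/=.
    by move=> x01; rewrite !tnth_mktuple/=; split=> // i; rewrite tnth_mktuple.
  exists (tnth t i0); first by rewrite in_itv.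
  by apply: eq_from_tnth => i; rewrite tnth_mktuple h.
apply: measurable_graph => i; rewrite /g.
case: (_ == _); first exact: measurable_id.
case: (_ <= _)%N; last exact: measurable_cst.
apply: nondecreasing_measurable => //; exact: transfer_nondecreasing.
Qed.

Lemma curve_dBE : piecewise_monotone_dBE_set A.
Proof.
split; last first.
  exists f, 0; split=> //; first by rewrite lexx ler01.
  by move=> i i1; apply: piecewise_monotone_transfer; lia.
split; first exact: measurable_curve.
  by move=> _ [x /=+ <-] i; rewrite in_itv/=; exact: curve_itv.
move=> _ _ [x /=+ <-] [y /=+ <-]; rewrite !in_itv/= => x01 y01 xy.
have n1 : (n.-1 < n)%N by rewrite prednK.
exists (Ordinal n1); split; first by rewrite !tnth_curve_last.
move=> i ixy; apply: val_inj => /=.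
case: (ltnP i n.-1) => i1; last by have := ltn_ord i; lia.
by exfalso; apply: xy; rewrite (curve_inj x01 y01 i1 ixy).
Qed.


(** * The upper bound *)

Definition arc k j : set (n.-tuple R) :=
  [set curve x | x in [set x : R | 0 <= x <= 1 /\ in_cell n k j 0 x]].

Lemma diam_arc_le k j :
  (diam (arc k j) <= (\sum_(0 <= i < n.-1) cell_len R n k j i)%:E)%E.
Proof.
apply: diam_le => [|_ _ [x [x01 cx] <-] [y [y01 cy] <-]].
  by apply: sumr_ge0 => i _; rewrite ltW ?cell_len_gt0.
apply: le_trans (eucl_dist_le_sum _ _) _.
rewrite big_mkord (big_ord_widen n) ?leq_pred// [leRHS]big_mkcond/=.
apply: ler_sum => i _; case: ifPn => [i1|]; last first.
  by rewrite -leqNgt => i1; rewrite !tnth_curve_last// subrr normr0.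
rewrite !tnth_curve//.
by apply: (@in_cell_dist _ n) => //; apply: transfer_cell.
Qed.

Lemma hausdorff1_delta_le (delta : R) : 0 < delta ->
  (hausdorff1_delta A delta <= (n%:R - 1)%:E)%E.
Proof.
move=> d0.
have [k kd] : exists k : nat, n%:R * k.+1%:R^-1 <= delta.
  have n0 : 0 < n%:R :> R by rewrite ltr0n.
  have [k kd] := ltr_add_invr (divr_gt0 d0 n0).
  exists k; rewrite add0r ltr_pdivlMr ?ltr0n// mulrC in kd; exact: ltW.
pose U j : set (n.-tuple R) := if (j < n ^ k)%N then arc k j else set0.
pose u j : R := if (j < n ^ k)%N then \sum_(0 <= i < n.-1) cell_len R n k j i else 0.
have len_le : (n.-1)%:R * k.+1%:R^-1 <= n%:R * k.+1%:R^-1 :> R.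
  by rewrite ler_wpM2r ?invr_ge0// ler_nat leq_pred.
have dU j : (diam (U j) <= (u j)%:E)%E.
  rewrite /U /u; case: ifP => _; last exact: diam_le.
  exact: diam_arc_le.
have u_le j : u j <= delta.
  rewrite /u; case: ifP => _; last exact: ltW.
  apply: le_trans kd; apply: le_trans len_le.
  rewrite -[X in X%:R * _]subn0 mulr_natl -sumr_const_nat.
  by apply: ler_sum => i _; exact: cell_len_le.
apply: (@le_trans _ _ (\sum_(0 <= i <oo) diam (U i))%E).
  apply: ereal_inf_lbound; exists U; split=> //.
    move=> _ [x /=+ <-]; rewrite in_itv/= => x01.
    have [j jk cj] := in_cell_exists n_gt1 k n_gt0 x01.
    by exists j => //; rewrite /U jk; exists x.
  by move=> i; rewrite (le_trans (dU i))// lee_fin.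
apply: (@le_trans _ _ (\sum_(0 <= i <oo) (u i)%:E)%E).
  by apply: lee_nneseries => // i _ _; exact: diam_ge0.
have u0 j : (0 <= (u j)%:E)%E := le_trans (diam_ge0 _) (dU j).
rewrite (nneseries_split _ (n ^ k))// add0n eseries0; last first.
  by move=> i ik _; rewrite /u ltnNge ik.
rewrite adde0 sumEFin lee_fin (eq_big_nat _ _ (F2 := fun j =>
  \sum_(0 <= i < n.-1) cell_len R n k j i)); last by move=> j /andP[_ jk]; rewrite /u jk.
rewrite exchange_big_nat/= (eq_big_nat _ _ (F2 := fun=> 1)); last first.
  by move=> i /andP[_ i1]; rewrite -[LHS]/(node R n k (n ^ k) i) node_end// n1_lt.
by rewrite sumr_const_nat subn0 -[n in n%:R - 1](prednK n_gt0) -natr1 addrK.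
Qed.

(** * The lower bound *)

(** The parameters of the trimmed arc in box [l]. It is trimmed in the coordinate
that box [l] favours, since only its projection there is used; the condition on
[l %% n] removes the children favouring the constant last coordinate. *)
Definition core k (s : R) l : set R := [set x | [/\ 0 <= x <= 1, (l %% n < n.-1)%N &
  node R n k l (l %% n) + s <= f (l %% n)%N x <= node R n k l.+1 (l %% n) - s]].

Lemma core_in_cell k s l x i : 0 <= s -> (i < n)%N -> core k s l x ->
  in_cell n k l i (f i x).
Proof.
move=> s0 iD [x01 /n1_lt lD h].
have cl : in_cell n k l (l %% n) (f (l %% n)%N x).
  by move: h; rewrite /in_cell => /andP[? ?]; apply/andP; split; lra.
apply: transfer_cell => //.
by rewrite -(transferK n_gt1 n_gt0 lD x01); apply: transfer_cell.
Qed.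

(** The later arc starts above the top corner of the earlier box, and the earlier
arc stops below that corner by the margin, in the favoured coordinate of the
earlier box. *)
Lemma core_separated k s l l' x y : 0 <= s -> (l < l')%N ->
  core k s l x -> core k s l' y -> s <= eucl_dist (curve x) (curve y).
Proof.
move=> s0 ll' cx cy; have [x01 l1 /andP[_ hx]] := cx; have [y01 _ _] := cy.
have /andP[hy _] := core_in_cell s0 (n1_lt l1) cy.
have hll : node R n k l.+1 (l %% n) <= node R n k l' (l %% n) by rewrite node_mono.
apply: le_trans (coord_le_eucl_dist _ _ (Ordinal (n1_lt l1))).
rewrite !tnth_curve//= ler_normr opprB; apply/orP; right; lra.
Qed.

Lemma core_image k s l y : 0 <= s -> (l < n ^ k)%N -> (l %% n < n.-1)%N ->
  node R n k l (l %% n) + s <= y <= node R n k l.+1 (l %% n) - s ->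
  exists2 x, core k s l x & f (l %% n)%N x = y.
Proof.
move=> s0 lk l1 hy; have lD := n1_lt l1.
have y01 : 0 <= y <= 1.
  have := node_ge0 R n_gt1 k l (l %% n).
  have : node R n k l.+1 (l %% n) <= 1 by rewrite -(node_end R n_gt1 k lD) node_mono.
  by case/andP: hy => ? ? ? ?; apply/andP; split; lra.
have e : f (l %% n)%N (transfer n (l %% n) 0 y) = y by rewrite transferK.
by exists (transfer n (l %% n) 0 y) => //; split; rewrite ?e//; exact: transfer_itv.
Qed.

(** The [i]-th children favour coordinate [i], hence carry the proportion
[k.+1 / k.+2] of its variation 1. *)
Lemma sum_core_len k :
  \sum_(0 <= l < n ^ k.+1 | (l %% n < n.-1)%N) cell_len R n k.+1 l (l %% n) =
  (n.-1)%:R * (k.+1%:R / k.+2%:R).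
Proof.
transitivity (\sum_(0 <= i < n.-1) \sum_(0 <= l < n ^ k.+1 | (l %% n == i)%N)
    cell_len R n k.+1 l i).
  rewrite (exchange_big_dep_nat (fun l => (l %% n < n.-1)%N))/=; last first.
    by move=> i l i1 _ _ /eqP ->.
  apply: eq_bigr => l l1.
  under eq_bigl do rewrite eq_sym.
  by rewrite big_nat1_eq l1.
rewrite (eq_big_nat _ _ (F2 := fun=> k.+1%:R / k.+2%:R)); last first.
  move=> i /andP[_ i1]; rewrite expnS (node_children R n_gt1 k _ i (pred1 i)).
  rewrite -mulr_suml -[X in X * _]/(node R n k (n ^ k) i) (node_end R n_gt1 k (n1_lt i1)) mul1r.
  by rewrite big_nat1_eq (n1_lt i1) /weight eqxx.
by rewrite sumr_const_nat subn0 -[LHS]mulr_natl.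
Qed.

(** The loss [n / k.+2] is the sum of the variation of the [n - 1] coordinates
outside their favoured boxes, [(n - 1) / k.+2], and of what is trimmed, at most
[1 / k.+2]. *)
Lemma hausdorff1_delta_ge k : exists2 s : R, 0 < s & forall delta, delta < s ->
  ((n%:R - 1 - n%:R / k.+2%:R)%:E <= hausdorff1_delta A delta)%E.
Proof.
set N := (n ^ k.+1)%N.
have N0 : 0 < N%:R :> R by rewrite ltr0n expn_gt0 n_gt0.
have k0 : 0 < k.+2%:R :> R by rewrite ltr0n.
(* Trimming both ends of N arcs by s then costs 1 / k.+2 in total. *)
pose s : R := (2 * N%:R * k.+2%:R)^-1.
have s0 : 0 < s by rewrite invr_gt0 !mulr_gt0.
exists s => // delta ds; apply: le_ereal_inf_tmp => _ [U [cov dU ->]].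
(* w l m counts the diameter of U m when U m meets the l-th trimmed arc. *)
pose Q l := (l %% n < n.-1)%N.
pose V l m : set R := [set y | exists2 x, core k.+1 s l x /\ U m (curve x) &
  y = f (l %% n)%N x].
pose w l m : \bar R := if `[< V l m !=set0 >] then diam (U m) else 0%E.
have w0 l m : (0 <= w l m)%E by rewrite /w; case: ifP => // _; exact: diam_ge0.
have covered l : (l < N)%N -> Q l ->
    ((cell_len R n k.+1 l (l %% n) - 2 * s)%:E <= \sum_(0 <= m <oo) w l m)%E.
  move=> lN Ql.
  have -> : cell_len R n k.+1 l (l %% n) - 2 * s =
      (node R n k.+1 l.+1 (l %% n) - s) - (node R n k.+1 l (l %% n) + s).
    by rewrite nodeS; ring.
  apply: (itv_cover_le (V := V l)) => //.
    move=> m _ _ [x [cx Ux] ->] [y [cy Uy] ->].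
    have -> : w l m = diam (U m).
      by rewrite /w asboolT//; exists (f (l %% n)%N x); exists x.
    apply: le_trans (eucl_dist_le_diam Ux Uy).
    rewrite lee_fin; apply: le_trans (coord_le_eucl_dist _ _ (Ordinal (n1_lt Ql))).
    by have [x01 _ _] := cx; have [y01 _ _] := cy; rewrite !tnth_curve.
  move=> y; rewrite /= in_itv/= => hy.
  have [x cx <-] := core_image (ltW s0) lN Ql hy.
  have [x01 _ _] := cx.
  have [m _ Um] : (\bigcup_m U m) (curve x) by apply: cov; exists x => //=; rewrite in_itv.
  by exists m => //; exists x.
have disj m : (\sum_(0 <= l < N | Q l) w l m <= diam (U m))%E.
  have [[l lN [x [cx Ux] _]]|no] := pselect (exists2 l, (l < N)%N & exists2 x,
      core k.+1 s l x /\ U m (curve x) & Q l); last first.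
    rewrite big_nat_cond big1 ?diam_ge0// => l /andP[/andP[_ lN] Ql].
    rewrite /w asboolF// => -[_ [x h _]]; apply: no.
    by exists l => //; exists x.
  rewrite big_mkord (bigD1 (Ordinal lN))/=; last by have [] := cx.
  rewrite big1 ?adde0.
    by rewrite /w; case: ifP => // _; exact: diam_ge0.
  move=> l' /andP[_]; rewrite -val_eqE/= => ll'.
  rewrite /w asboolF// => -[_ [y [cy Uy] _]].
  have dlt z t : U m z -> U m t -> eucl_dist z t < s.
    move=> Uz Ut; apply: le_lt_trans ds; rewrite -lee_fin.
    exact: le_trans (eucl_dist_le_diam Uz Ut) (dU m).
  case: (ltngtP l' l) ll' => // ll' _.
  - by have := core_separated (ltW s0) ll' cy cx; rewrite leNgt dlt.
  - by have := core_separated (ltW s0) ll' cx cy; rewrite leNgt dlt.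
apply: (@le_trans _ _ (\sum_(0 <= m <oo) \sum_(0 <= l < N | Q l) w l m)%E); last first.
  apply: lee_nneseries => [m _ _|m _]; first exact: sume_ge0.
  exact: disj.
rewrite nneseries_sum//.
apply: (@le_trans _ _ (\sum_(0 <= l < N | Q l)
    (cell_len R n k.+1 l (l %% n) - 2 * s)%:E)%E); last first.
  rewrite big_nat_cond [leRHS]big_nat_cond.
  by apply: lee_sum => l /andP[/andP[_ lN] Ql]; exact: covered.
rewrite sumEFin lee_fin sumrB sum_core_len.
have le2 : \sum_(0 <= l < N | Q l) 2 * s <= k.+2%:R^-1.
  rewrite big_mkcond/=.
  apply: (@le_trans _ _ (\sum_(0 <= l < N) 2 * s)).
    by apply: ler_sum => l _; case: ifP => // _; rewrite mulr_ge0// ltW.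
  rewrite sumr_const_nat subn0 -[leLHS]mulr_natr.
  have -> // : 2 * s * N%:R = k.+2%:R^-1.
  by rewrite /s; field; rewrite !gt_eqF.
have e : (n.-1)%:R = n%:R - 1 :> R by rewrite -[n in RHS](prednK n_gt0) -natr1 addrK.
have ek : k.+1%:R = k.+2%:R - 1 :> R by rewrite -[k.+2%:R]natr1 addrK.
rewrite e ek.
have -> : (n%:R - 1) * ((k.+2%:R - 1) / k.+2%:R) =
    n%:R - 1 - n%:R / k.+2%:R + k.+2%:R^-1 :> R by field; rewrite gt_eqF.
by rewrite -[leRHS]addrA lerDl subr_ge0.
Qed.

Lemma hausdorff1_curve : hausdorff1 A = (n%:R - 1)%:E.
Proof.
have nR : 0 < n%:R :> R by rewrite ltr0n.
apply: cvg_lim => //; apply/fine_cvgP.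
have bounds e : 0 < e -> \forall d \near 0^'+,
    ((n%:R - 1 - e)%:E <= hausdorff1_delta A d <= (n%:R - 1)%:E)%E.
  move=> e0; have [k] := ltr_add_invr (divr_gt0 e0 nR).
  rewrite add0r ltr_pdivlMr// => ke.
  have [s s0 hs] := hausdorff1_delta_ge k.
  near=> d; rewrite hausdorff1_delta_le ?andbT//.
  apply: le_trans (hs d _) => //; rewrite lee_fin lerD2l lerN2.
  apply: le_trans (ltW ke); rewrite mulrC ler_wpM2r ?(ltW nR)//.
  by rewrite lef_pV2 ?posrE ?ltr0n// ler_nat.
split.
  have := bounds 1 ltr01; apply: filterS => d /andP[l u].
  by rewrite fin_numE; apply/andP; split; apply/eqP => e; move: l u; rewrite e.
apply/cvgrPdist_le => e /bounds; apply: filterS => d /= /andP[].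
case: (hausdorff1_delta A d) => //= r; rewrite !lee_fin => l u.
by rewrite ger0_norm; lra.
Unshelve. all: by end_near.
Qed.

End Curve.

Theorem theorem1p5 (R : realType) (n : nat) (hn : (2 <= n)%N) :
  exists A : set (n.-tuple R),
    piecewise_monotone_dBE_set A /\ hausdorff1 A = (n%:R - 1)%:E.
Proof.
exists [set graph_point n (@transfer R n 0) 0 x | x in `[0, 1]%classic].
by split; [exact: curve_dBE | exact: hausdorff1_curve].
Qed.
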